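(* Let $K$ be a field, let $c,d$ be positive integers, and let $I=\langle x^c,m,y^d\rangle\subset K[x,y]$, where either $m=0$ or $m=x^uy^v$ is a monomial lying in $I(c,d)$, the integral closure of the ideal $\langle x^c,y^d\rangle$. Then all powers of $I$ are Ratliff-Rush, i.e. $\widetilde{I^l}=I^l$ for every integer $l\ge1$.
   Context: For a regular ideal $J$ (one containing a nonzerodivisor) of a commutative Noetherian ring $R$, the Ratliff-Rush closure of $J$ is $\widetilde{J}=\bigcup_{k\ge 1}(J^{k+1}:J^{k})$, where $J^{k+1}:J^k=\{z\in R\mid zJ^k\subseteq J^{k+1}\}$. The ideal $J$ is called Ratliff-Rush if $J=\widetilde J$. The integral closure of an ideal $J$ of $R$ is the set of $z\in R$ satisfying an equation $z^k+c_1z^{k-1}+\cdots+c_k=0$ with $c_i\in J^i$. *)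

(* Defs.v *)
From HB Require Import structures.
From mathcomp Require Export all_boot all_order all_algebra.
From mathcomp Require Export classical_sets mpoly.

Set Implicit Arguments.
Unset Strict Implicit.
Unset Printing Implicit Defensive.

Import GRing.Theory.

Local Open Scope classical_set_scope.
Local Open Scope ring_scope.

Section Ideals.
Variable R : comNzRingType.
Implicit Types (S J L : set R) (z : R).

(* Ideals are represented by their underlying sets of elements. *)
Definition ideal_gen S : set R :=
  [set z | exists n (a g : 'I_n -> R),
     (forall i, S (g i)) /\ z = \sum_(i < n) a i * g i].

Definition ideal_mul J L : set R :=
  ideal_gen [set z | exists x y, [/\ J x, L y & z = x * y]].

(* The zeroth power is the unit ideal. *)
Definition ideal_exp J (n : nat) : set R := iter n (ideal_mul J) [set: R].

Definition ideal_colon J L : set R := [set z | forall w, L w -> J (z * w)].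

(* [GRing.lreg r] says that multiplication by r is injective, i.e. that r is a
   nonzerodivisor. *)
Definition regular_ideal J : Prop := exists2 r, J r & GRing.lreg r.

Definition ratliff_rush_closure J : set R :=
  [set z | exists2 k, (1 <= k)%N &
     ideal_colon (ideal_exp J k.+1) (ideal_exp J k) z].

Definition ratliff_rush J : Prop :=
  regular_ideal J /\ ratliff_rush_closure J = J.

Definition integral_closure J : set R :=
  [set z | exists k (c : nat -> R),
     [/\ (1 <= k)%N,
         forall i, (1 <= i <= k)%N -> ideal_exp J i (c i)
       & z ^+ k + \sum_(1 <= i < k.+1) c i * z ^+ (k - i) = 0]].

End Ideals.

Section TwoVariables.
Variable K : fieldType.

Definition varx : {mpoly K[2]} := 'X_(ord0 : 'I_2).
Definition vary : {mpoly K[2]} := 'X_(ord_max : 'I_2).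

End TwoVariables.

Arguments varx {K}.
Arguments vary {K}.

(* Main.v *)
Require Import Defs.
From mathcomp Require Import zify ring.

(** Write I for the ideal generated by x^c, x^u y^v and y^d. All powers of an
    ideal I containing a nonzerodivisor are Ratliff-Rush as soon as
    I^(n+1) : I = I^n for every n: removing one factor I at a time gives
    I^(n+k) : I^k = I^n, and (I^l)^k = I^(lk) (lemma [ratliff_rush_exp]).

    The power I^n consists of the polynomials all of whose monomials
    x^a y^b are divisible by some x^(ci) (x^u y^v)^j y^(dk) with
    i + j + k = n (lemma [ideal_exp_three_monomials]). Multiplication by a
    monomial shifts the support of a polynomial, so the cancellation of I
    reduces to a statement about exponents ([power_exponents_cancel]).

    Suppose that x^(a+c) y^b and x^a y^(b+d) both lie in I^(n+1). If the
    divisor of x^(a+c) y^b given above has i > 0, dropping one factor x^c from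
    it leaves a divisor of x^a y^b in I^n; the same holds if the divisor of
    x^a y^(b+d) has a factor y^d. Otherwise the first divisor is made of
    n + 1 factors x^u y^v or y^d, so that b >= (n+1) min(v,d), and the second
    one of factors x^c or x^u y^v, so that a >= (n+1) min(c,u). Hence x^a y^b
    is divisible by y^(dn) if d <= v, by x^(cn) if c <= u, and by
    (x^u y^v)^n in the remaining case u < c, v < d: it lies in I^n in all
    cases. The case m = 0 is the one where the monomial is y^d again. *)

Set Implicit Arguments.
Unset Strict Implicit.
Unset Printing Implicit Defensive.

Import GRing.Theory.

Local Open Scope classical_set_scope.
Local Open Scope ring_scope.

(** * Products and powers of ideals *)

Section IdealArithmetic.
Variable R : comNzRingType.
Implicit Types (S J L M : set R) (x y z : R).

Definition is_ideal J : Prop :=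
  [/\ J 0, forall x y, J x -> J y -> J (x + y) & forall a x, J x -> J (a * x)].

Lemma is_ideal_sum J (I : Type) (r : seq I) (P : pred I) (F : I -> R) :
  is_ideal J -> (forall i, P i -> J (F i)) -> J (\sum_(i <- r | P i) F i).
Proof. by case=> J0 JD _ JF; apply: (big_ind J). Qed.

Lemma is_ideal_setT : is_ideal [set: R].
Proof. by []. Qed.

Lemma ideal_gen_sub S J : is_ideal J -> S `<=` J -> ideal_gen S `<=` J.
Proof.
move=> JI SJ _ [n [a [g [Sg ->]]]]; apply: is_ideal_sum => // i _.
by case: JI => _ _; apply; apply: SJ.
Qed.

Lemma sub_ideal_gen S : S `<=` ideal_gen S.
Proof.
move=> x Sx; exists 1, (fun=> 1), (fun=> x).
by rewrite big_ord1 mul1r.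
Qed.

Lemma is_ideal_gen S : is_ideal (ideal_gen S).
Proof.
split=> [|x y|b x].
- by exists 0, (fun=> 0), (fun=> 0); split=> [[]|]; rewrite ?big_ord0.
- move=> [n1 [a1 [g1 [Sg1 ->]]]] [n2 [a2 [g2 [Sg2 ->]]]].
  exists (n1 + n2)%N,
    (fun i => match split i with inl j => a1 j | inr j => a2 j end),
    (fun i => match split i with inl j => g1 j | inr j => g2 j end).
  split=> [i|]; first by case: (split i).
  rewrite big_split_ord; congr (_ + _); apply: eq_bigr => i _.
    by rewrite (unsplitK (inl i)).
  by rewrite (unsplitK (inr i)).
- move=> [n [a [g [Sg ->]]]]; exists n, (fun i => b * a i), g; split=> //.
  by rewrite mulr_sumr; apply: eq_bigr => i _; rewrite mulrA.
Qed.

Lemma ideal_gen0 S : ideal_gen S 0.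
Proof. by case: (is_ideal_gen S). Qed.

Lemma is_ideal_mul J L : is_ideal (ideal_mul J L).
Proof. exact: is_ideal_gen. Qed.

Lemma ideal_mul_mem J L x y : J x -> L y -> ideal_mul J L (x * y).
Proof. by move=> Jx Ly; apply: sub_ideal_gen; exists x, y. Qed.

Lemma ideal_mul_sub J L M :
    is_ideal M -> (forall x y, J x -> L y -> M (x * y)) -> ideal_mul J L `<=` M.
Proof.
by move=> MI JLM; apply: ideal_gen_sub => // _ [x [y [Jx Ly ->]]]; apply: JLM.
Qed.

(** Lets an inclusion [J * L `<=` M] be checked on generators while a further
    factor y is kept fixed, as in the associativity of the product. *)
Lemma is_ideal_colon1 J y : is_ideal J -> is_ideal [set x | J (x * y)].
Proof.
case=> J0 JD JM; split=> [|x1 x2 Jx1 Jx2|a x Jx] /=.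
- by rewrite mul0r.
- by rewrite mulrDl; apply: JD.
- by rewrite -mulrA; apply: JM.
Qed.

Lemma ideal_mulC J L : ideal_mul J L = ideal_mul L J.
Proof.
have sub (A B : set R) : ideal_mul A B `<=` ideal_mul B A.
  apply: (ideal_mul_sub (is_ideal_mul _ _)) => x y Ax By.
  by rewrite mulrC; apply: ideal_mul_mem.
by apply/seteqP; split; apply: sub.
Qed.

Lemma ideal_mulA J L M :
  ideal_mul J (ideal_mul L M) = ideal_mul (ideal_mul J L) M.
Proof.
have sub (A B C : set R) :
    ideal_mul (ideal_mul A B) C `<=` ideal_mul A (ideal_mul B C).
  apply: (ideal_mul_sub (is_ideal_mul _ _)) => x z ABx Cz.
  have := is_ideal_colon1 z (is_ideal_mul A (ideal_mul B C)).
  move/ideal_mul_sub; apply; last exact: ABx.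
  by move=> a b Aa Bb /=; rewrite -mulrA; do 2!apply: ideal_mul_mem => //.
apply/seteqP; split; last exact: sub.
rewrite ideal_mulC (ideal_mulC L) (ideal_mulC _ M) (ideal_mulC J).
exact: sub.
Qed.

Lemma ideal_mul1 J : is_ideal J -> ideal_mul [set: R] J = J.
Proof.
move=> JI; apply/seteqP; split=> [|x Jx].
  by apply: ideal_mul_sub => // x y _; case: JI => _ _; apply.
by rewrite -[x]mul1r; apply: ideal_mul_mem.
Qed.

Lemma is_ideal_exp J n : is_ideal (ideal_exp J n).
Proof. by case: n => [|n]; [apply: is_ideal_setT | apply: is_ideal_mul]. Qed.

Lemma ideal_expD J n1 n2 :
  ideal_exp J (n1 + n2) = ideal_mul (ideal_exp J n1) (ideal_exp J n2).
Proof.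
elim: n1 => [|n1 IH]; first by rewrite ideal_mul1 //; apply: is_ideal_exp.
by rewrite addSn /= -/(ideal_exp _ _) IH ideal_mulA.
Qed.

Lemma ideal_expM J l k : ideal_exp (ideal_exp J l) k = ideal_exp J (l * k).
Proof.
elim: k => [|k IH]; first by rewrite muln0.
by rewrite mulnS ideal_expD -IH.
Qed.

Lemma ideal_exp_mem J x n : J x -> ideal_exp J n (x ^+ n).
Proof.
by move=> Jx; elim: n => [//|n IH]; rewrite exprS; apply: ideal_mul_mem.
Qed.

(** If w lies in J^k and g in J, then wg lies in J^(k+1); so when z sends
    J^(k+1) into J^(n+k+1), each zw lies in J^(n+k+1) : J, and the hypothesis
    moves it down to J^(n+k). *)
Lemma ideal_colon_exp J :
    (forall n, ideal_colon (ideal_exp J n.+1) J `<=` ideal_exp J n) ->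
  forall n k, ideal_colon (ideal_exp J (n + k)) (ideal_exp J k)
              `<=` ideal_exp J n.
Proof.
move=> cancelJ n; elim=> [|k IH] z zJ.
  by have := zJ 1 I; rewrite mulr1 addn0.
apply: IH => w Jkw; apply: cancelJ => g Jg.
by rewrite -mulrA -addnS; apply: zJ; rewrite mulrC; apply: ideal_mul_mem.
Qed.

(** Since (J^l)^k = J^(lk), membership of z in the closure of J^l says that z
    lies in J^(l+lk) : J^(lk) for some k, so the cancellation of powers of J
    suffices for all l at once. *)
Lemma ratliff_rush_exp J :
    regular_ideal J ->
    (forall n, ideal_colon (ideal_exp J n.+1) J `<=` ideal_exp J n) ->
  forall l, ratliff_rush (ideal_exp J l).
Proof.
move=> [r Jr reg_r] cancelJ l; split.
  by exists (r ^+ l); [apply: ideal_exp_mem | apply: lregX].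
apply/seteqP; split=> z.
  move=> [k _]; rewrite !ideal_expM mulnS; exact: ideal_colon_exp.
by move=> Jz; exists 1%N => // w; apply: ideal_mul_mem.
Qed.

End IdealArithmetic.

(** * Polynomials with prescribed support *)

Section SupportIdeals.
Variables (n : nat) (K : nzRingType).
Implicit Types (E : set 'X_{1..n}) (p q : {mpoly K[n]}).

Definition supported E : set {mpoly K[n]} :=
  [set p | forall e, e \in msupp p -> E e].

Lemma supportedX E e : E e -> supported E 'X_[e].
Proof. by move=> Ee e'; rewrite msuppX inE => /eqP ->. Qed.

Lemma supportedM E1 E2 E p q :
    (forall e1 e2, E1 e1 -> E2 e2 -> E (e1 + e2)%MM) ->
  supported E1 p -> supported E2 q -> supported E (p * q).
Proof.
move=> E12 E1p E2q e /msuppM_le /allpairsP [[e1 e2] /= [pe1 qe2 ->]].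
by apply: E12; [apply: E1p | apply: E2q].
Qed.

Lemma supported_shift E e p :
  supported E (p * 'X_[e]) -> supported [set f | E (e + f)%MM] p.
Proof.
move=> Ep f pf; apply: Ep.
by rewrite (perm_mem (msuppMX _ _)); apply/mapP; exists f.
Qed.

End SupportIdeals.

Lemma is_ideal_supported n (K : comNzRingType) (E : set 'X_{1..n}) :
    (forall e1 e2, E e2 -> E (e1 + e2)%MM) ->
  is_ideal (supported E : set {mpoly K[n]}).
Proof.
move=> upE; split=> [e|p q Ep Eq e|a p]; first by rewrite msupp0.
- by move/msuppD_le; rewrite mem_cat => /orP [/Ep|/Eq].
- by apply: (@supportedM _ _ setT) => // e e' _; apply: upE.
Qed.

Lemma supported_sub n (K : comNzRingType) (E : set 'X_{1..n})
    (J : set {mpoly K[n]}) :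
  is_ideal J -> (forall e, E e -> J 'X_[e]) -> supported E `<=` J.
Proof.
move=> JI EJ p Ep; rewrite [p]mpolyE big_seq; apply: is_ideal_sum => // e pe.
by rewrite -mul_mpolyC; case: JI => _ _; apply; apply/EJ/Ep.
Qed.

(** * Powers of an ideal generated by three monomials in two variables *)

Section ThreeGenerators.
Variables (c d u v : nat).

Definition power_exponents (n : nat) : set 'X_{1..2} :=
  [set e | exists i j k, [/\ i + j + k = n, c * i + u * j <= e ord0
                           & v * j + d * k <= e ord_max]%N].

Lemma power_exponents_up n e1 e2 :
  power_exponents n e2 -> power_exponents n (e1 + e2)%MM.
Proof.
by move=> [i [j [k [? ? ?]]]]; exists i, j, k; rewrite !mnmDE; split; lia.
Qed.

Lemma power_exponentsD n1 n2 e1 e2 :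
    power_exponents n1 e1 -> power_exponents n2 e2 ->
  power_exponents (n1 + n2) (e1 + e2)%MM.
Proof.
move=> [i [j [k [? ? ?]]]] [i' [j' [k' [? ? ?]]]].
by exists (i + i')%N, (j + j')%N, (k + k')%N; rewrite !mnmDE; split; lia.
Qed.

(** The combinatorial core: a monomial lies in the n-th power when its products
    with x^c and with y^d lie in the next one. If neither membership uses the
    generator that was multiplied in, the two exponents are so large that the
    n-th power of a single generator divides the monomial; which generator
    depends on how u compares with c and v with d. *)
Lemma power_exponents_cancel n e :
    power_exponents n.+1 (U_(ord0) *+ c + e)%MM ->
    power_exponents n.+1 (U_(ord_max) *+ d + e)%MM ->
  power_exponents n e.
Proof.
rewrite /power_exponents /= !mnmDE !mulmnE !mnm1E !eqxx /= !mul0n !mul1n.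
move=> [[|i] [j [k [ijk le_a le_b]]]]; last first.
  (* A factor x^c is present and can be dropped. *)
  by move=> _; exists i, j, k; split; lia.
move=> [i' [j' [[|k'] [ijk' le_a' le_b']]]]; last first.
  (* A factor y^d is present and can be dropped. *)
  by exists i', j', k'; split; lia.
(* Now j + k = i' + j' = n + 1, hence e ord_max >= (n + 1) * minn v d and
   e ord0 >= (n + 1) * minn c u. *)
have [le_dv|lt_vd] := leqP d v.
  by exists 0%N, 0%N, n; split; nia.
have [le_cu|lt_uc] := leqP c u.
  by exists n, 0%N, 0%N; split; nia.
by exists 0%N, n, 0%N; split; nia.
Qed.

Variable K : fieldType.

Let x : {mpoly K[2]} := varx.
Let y : {mpoly K[2]} := vary.
Let J : set {mpoly K[2]} := ideal_gen [set x ^+ c; x ^+ u * y ^+ v; y ^+ d].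

(** Membership in a power of J becomes a condition on each monomial. The two
    inclusions hold because exponents add up under products, and because a
    monomial whose exponent is admissible is a multiple of an n-fold product of
    generators. *)
Lemma ideal_exp_three_monomials n :
  ideal_exp J n = supported (power_exponents n).
Proof.
have JI := is_ideal_exp J.
have suppI k := is_ideal_supported K (@power_exponents_up k).
have xE k : x ^+ k = 'X_[U_(ord0) *+ k] by rewrite mpolyXn.
have yE k : y ^+ k = 'X_[U_(ord_max) *+ k] by rewrite mpolyXn.
have J1 : J `<=` supported (power_exponents 1).
  apply: ideal_gen_sub => // p [[->|->]|->]; rewrite ?xE ?yE -?mpolyXD;
    apply: supportedX;
    [exists 1%N, 0%N, 0%N|exists 0%N, 1%N, 0%N|exists 0%N, 0%N, 1%N];
    by rewrite ?mnmDE !mulmnE !mnm1E /=; split; lia.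
have Jx : J (x ^+ c) by apply: sub_ideal_gen; left; left.
have Jm : J (x ^+ u * y ^+ v) by apply: sub_ideal_gen; left; right.
have Jy : J (y ^+ d) by apply: sub_ideal_gen; right.
apply/seteqP; split.
  elim: n => [|n IH]; first by move=> p _ e _; exists 0%N, 0%N, 0%N; split; lia.
  apply: ideal_mul_sub => // p q /J1 + /IH.
  by apply: supportedM => e1 e2; apply: power_exponentsD.
apply: supported_sub => // e [i [j [k [<- le_a le_b]]]].
have -> : 'X_[e] = x ^+ (e ord0 - (c * i + u * j))
    * y ^+ (e ord_max - (v * j + d * k))
    * ((x ^+ c) ^+ i * (x ^+ u * y ^+ v) ^+ j * (y ^+ d) ^+ k) :> {mpoly K[2]}.
  rewrite exprMn -!exprM.
  transitivity (x ^+ (e ord0 - (c * i + u * j) + (c * i + u * j))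
    * y ^+ (e ord_max - (v * j + d * k) + (v * j + d * k))).
    rewrite !subnK // mpolyXE_id big_ord_recl big_ord1 /=.
    by congr (_ * _ ^+ _); congr (_ _); apply: val_inj.
  by rewrite !exprD; ring.
case: (JI (i + j + k)%N) => _ _; apply.
by rewrite !ideal_expD; do ![apply: ideal_mul_mem | apply: ideal_exp_mem].
Qed.

(** The products of z by x^c and by y^d suffice: each shifts the support
    of z by a fixed exponent, so no cancellation between monomials occurs. *)
Lemma three_monomials_colon n :
  ideal_colon (ideal_exp J n.+1) J `<=` ideal_exp J n.
Proof.
move=> z zJ; rewrite ideal_exp_three_monomials => e ze.
have shift i b : J ('X_i ^+ b) -> power_exponents n.+1 (U_(i) *+ b + e)%MM.
  move=> /zJ; rewrite ideal_exp_three_monomials mpolyXn.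
  by move/supported_shift; apply.
by apply: power_exponents_cancel; apply: shift; apply: sub_ideal_gen;
  [left; left | right].
Qed.

Lemma three_monomials_ratliff_rush l : ratliff_rush (ideal_exp J l).
Proof.
apply: (ratliff_rush_exp _ three_monomials_colon).
exists (x ^+ c); first by apply: sub_ideal_gen; left; left.
by apply: lregX; apply: mulfI; rewrite -msupp_eq0 msuppX.
Qed.

End ThreeGenerators.

Theorem corollary12 (K : fieldType) (c d : nat) (m : {mpoly K[2]})
    (hc : (0 < c)%N) (hd : (0 < d)%N)
    (hm : m = 0 \/
          exists u v : nat,
            m = varx ^+ u * vary ^+ v /\
            integral_closure (ideal_gen [set varx ^+ c; vary ^+ d]) m)
    (l : nat) (hl : (1 <= l)%N) :
  ratliff_rush (ideal_exp (ideal_gen [set varx ^+ c; m; vary ^+ d]) l).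
Proof.
case: hm => [->|[u [v [-> _]]]]; last exact: three_monomials_ratliff_rush.
suff -> : ideal_gen [set varx ^+ c; 0; vary ^+ d] =
    ideal_gen [set varx ^+ c; varx ^+ 0 * vary ^+ d; vary ^+ d]
      :> set {mpoly K[2]} by exact: three_monomials_ratliff_rush.
rewrite expr0 mul1r; apply/seteqP.
split; apply: ideal_gen_sub; try exact: is_ideal_gen.
  move=> p [[->|->]|->]; first by apply: sub_ideal_gen; left; left.
    exact: ideal_gen0.
  by apply: sub_ideal_gen; right.
move=> p [[->|->]|->]; apply: sub_ideal_gen; first by left; left.
  by right.
by right.
Qed.
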